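(* Let $n \ge 1$ and $s \in \mathbb{Z}$. (a) If $-\lfloor (n-1)/2 \rfloor \le s \le n-1$, then with $n_s = n - s - 1$, $$H_s(n) = \sum_{k = \max(0,-s)}^{\lfloor n_s/3 \rfloor} \binom{2k+s}{k} \binom{n_s - 2k}{k},$$ and $H_s(n) = 0$ for all other integers $s$. (b) If $-\lfloor n/2 \rfloor \le s \le \max(0, n-3)$, then with $n'_s = n - s$, $$T_s(n) = 1_{s=0} + \sum_{k = \max(1,-s)}^{\lfloor n'_s/3 \rfloor} \binom{2k+s-1}{k-1} \binom{n'_s - 2k}{k},$$ and $T_s(n) = 0$ for all other integers $s$.
   Context: For a binary sequence $x = (x_1,\dots,x_n) \in \{0,1\}^n$ define the score $$S(x) = \sum_{i=1}^{n-1} I[x_i = x_{i+1} = 1] - \sum_{i=1}^{n-1} I[x_i = 1,\ x_{i+1} = 0].$$ For $s \in \mathbb{Z}$, $H_s(n)$ denotes the number of $x \in \{0,1\}^n$ with $x_n = 1$ and $S(x) = s$ (''heady-$s$'' sequences), and $T_s(n)$ the number of $x \in \{0,1\}^n$ with $x_n = 0$ and $S(x) = s$ (''taily-$s$'' sequences). $1_{s=0}$ is $1$ if $s=0$ and $0$ otherwise; empty sums equal $0$. *)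

(* Defs.v *)
(* Written on top of the Mathematical Components library. *)
From mathcomp Require Import all_boot all_order all_algebra.

Set Implicit Arguments.
Unset Strict Implicit.
Unset Printing Implicit Defensive.

Import Order.TTheory GRing.Theory Num.Theory.
Local Open Scope ring_scope.

(* Binary sequences of length n are n.-tuple bool, with true for 1 and false  *)
(* for 0. Positions are numbered from 0: x_i is nth false x i.-1, and the sum *)
(* over 1 <= i <= n - 1 becomes a sum over 0 <= i < n.-1.                     *)
Definition score (n : nat) (x : n.-tuple bool) : int :=
  \sum_(0 <= i < n.-1) (nth false x i && nth false x i.+1)%:Z
  - \sum_(0 <= i < n.-1) (nth false x i && ~~ nth false x i.+1)%:Z.

(* The last entry x_n is nth false x n.-1; this is meaningful for n >= 1. *)
Definition heady (s : int) (n : nat) : nat :=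
  #|[set x : n.-tuple bool | (nth false x n.-1 == true) && (score x == s)]|.

Definition taily (s : int) (n : nat) : nat :=
  #|[set x : n.-tuple bool | (nth false x n.-1 == false) && (score x == s)]|.

(* Main.v *)
(* A sequence whose ones number a and whose pattern 10 occurs k times has score
   a - 2k - 1 if it ends in 1 and a - 2k if it ends in 0.  The k-th summands
   count the sequences with these statistics: in each, one binomial coefficient
   splits the ones into runs and the other one splits the zeros.  Removing the
   last entry gives the same recurrence for the counts and for the summands,
   where it is Pascal's rule applied to one of the two binomial coefficients. *)
Require Import Defs.
From mathcomp Require Import all_boot all_order all_algebra.
From mathcomp Require Import zify.

Set Implicit Arguments.
Unset Strict Implicit.
Unset Printing Implicit Defensive.

Import Order.TTheory GRing.Theory Num.Theory.
Local Open Scope ring_scope.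

Lemma card_tuple_rcons (T : finType) n (P : pred (n.+1.-tuple T)) :
  #|[set y | P y]| = (\sum_(b : T) #|[set x | P (rcons_tuple x b)]|)%N.
Proof.
pose f (p : T * n.-tuple T) := rcons_tuple p.2 p.1.
have f_bij : bijective f.
  apply: inj_card_bij => [[b x] [c y] /(congr1 val)/= /rcons_inj[/val_inj-> ->] //|].
  by rewrite card_prod !card_tuple expnS.
rewrite -sum1_card (reindex f) /=; last exact/onW_bij.
under eq_bigl do rewrite inE.
under [RHS]eq_bigr do rewrite -sum1_card (eq_bigl _ _ (fun x => in_set _ x)).
by rewrite pair_big_dep.
Qed.

Lemma nth_rcons_pred n (x : n.-tuple bool) b : nth false (rcons x b) n = b.
Proof. by rewrite nth_rcons size_tuple ltnn eqxx. Qed.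

Lemma score_rcons n (x : n.-tuple bool) b :
  score (rcons_tuple x b) =
  score x + (nth false x n.-1 && b)%:Z - (nth false x n.-1 && ~~ b)%:Z.
Proof.
case: n x => [|n] x.
  (* On the empty tuple [nth] returns its default [false], so both corrections vanish. *)
  by rewrite /score /= !big_geq // tuple0.
have nthE i : (i <= n)%N -> nth false (rcons x b) i = nth false x i.
  by move=> le_in; rewrite nth_rcons size_tuple ltnS le_in.
have sumE (g : bool -> bool -> bool) :
    \sum_(0 <= i < n) (g (nth false (rcons x b) i) (nth false (rcons x b) i.+1))%:Z
    = \sum_(0 <= i < n) (g (nth false x i) (nth false x i.+1))%:Z.
  by apply: eq_big_nat => i /andP[_ lt_in]; rewrite !nthE // ltnW.
rewrite /score /= !big_nat_recr //= nth_rcons_pred nthE //.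
by rewrite (sumE andb) (sumE (fun c d => c && ~~ d)) opprD !addrA [X in X - _]addrAC.
Qed.

Lemma card_andb_split (T : finType) (b P Q : pred T) :
  #|[set x | if b x then P x else Q x]| =
  (#|[set x | (b x == true) && P x]| + #|[set x | (b x == false) && Q x]|)%N.
Proof.
rewrite -cardsUI -[LHS]addn0; congr (_ + _)%N.
  by apply: eq_card => x; rewrite !inE; case: (b x); rewrite ?orbF.
by apply/esym/eqP; rewrite cards_eq0; apply/eqP/setP=> x; rewrite !inE; case: (b x); rewrite ?andbF.
Qed.

(** A final 1 adds one to the score when it follows a 1 and nothing when it follows a 0. *)
Lemma heady_rec s n : heady s n.+1 = (heady (s - 1) n + taily s n)%N.
Proof.
rewrite /heady card_tuple_rcons big_bool /= [X in (_ + X)%N]eq_card0 ?addn0; last first.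
  by move=> x; rewrite !inE nth_rcons_pred.
rewrite -card_andb_split; apply: eq_card => x.
rewrite !inE nth_rcons_pred score_rcons /=.
by case: (nth _ _ _) => /=; lia.
Qed.

Lemma taily_rec s n : taily s n.+1 = (taily s n + heady (s + 1) n)%N.
Proof.
rewrite /taily card_tuple_rcons big_bool /= [X in (X + _)%N]eq_card0 ?add0n; last first.
  by move=> x; rewrite !inE nth_rcons_pred.
rewrite addnC -card_andb_split; apply: eq_card => x.
rewrite !inE nth_rcons_pred score_rcons /=.
by case: (nth _ _ _) => /=; lia.
Qed.

Lemma heady0 s : heady s 0 = 0%N.
Proof. by apply: eq_card0 => x; rewrite !inE tuple0. Qed.

(** By the default of [nth] the empty sequence counts as taily, so the induction can start at length
    0. *)
Lemma taily0 s : taily s 0 = (s == 0).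
Proof.
rewrite /taily; case: eqP => [->|s_neq0].
  rewrite [LHS](@eq_card _ _ predT) ?card_tuple // => x.
  by rewrite !inE tuple0 /score !big_geq.
by apply: eq_card0 => x; rewrite !inE tuple0 /score !big_geq //= subr0; apply/eqP; lia.
Qed.

(* In both terms b + 1 is the number of ones; the branch k = 0 of taily_term is
   the all-zero sequence. *)
Definition heady_term (n : nat) (s : int) (k : nat) : nat :=
  if (2 * k%:Z + s)%R is Posz b then
    if (b < n)%N then ('C(b, k) * 'C(n - b.+1, k))%N else 0
  else 0.

Definition taily_term (n : nat) (s : int) (k : nat) : nat :=
  if k is j.+1 then
    if (2 * k%:Z + s - 1)%R is Posz b then
      if (b < n)%N then ('C(b, j) * 'C(n - b.+1, k))%N else 0
    else 0
  else s == 0%R.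

(** Pascal's rule on the first binomial, the one that splits the ones. *)
Lemma heady_term_rec n s k :
  heady_term n.+1 s k = (heady_term n (s - 1) k + taily_term n s k)%N.
Proof.
rewrite /heady_term /taily_term addrA; case: k => [|j].
  rewrite mulr0 !add0r; case: s => [[|b]|b] //=.
    by rewrite !bin0.
  by rewrite subn1 /= !bin0 addn0.
case: (2 * _ + s) => [[|b]|b] //=.
by rewrite subn1 /= ltnS subSS binS mulnDl; case: ltnP.
Qed.

(** Pascal's rule on the second binomial, the one that splits the zeros; [k] drops by one when the
    removed 0 ends a pattern 10. *)
Lemma taily_term_recS n s j :
  taily_term n.+1 s j.+1 = (taily_term n s j.+1 + heady_term n (s + 1) j)%N.
Proof.
rewrite /heady_term /taily_term.
have -> : 2 * j.+1%:Z + s - 1 = 2 * j%:Z + (s + 1) by lia.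
case: (2 * _ + _) => // b; rewrite ltnS subSS.
(* At [b = n] only the guard on the left holds, and there ['C(0, j.+1) = 0]. *)
case: (ltngtP b n) => // [lt_bn|->]; last by rewrite subnn bin0n muln0.
by rewrite -(subnSK lt_bn) binS mulnDr.
Qed.

(** Each inequality says that the lower index of one binomial is at most its upper index; together
    they give the summation bounds. *)
Lemma heady_term_eq0 n s k :
  ~~ ((0 <= k%:Z + s) && (3 * k%:Z + s <= n%:Z - 1)) -> heady_term n s k = 0%N.
Proof.
rewrite /heady_term; case E: (2 * _ + s) => [b|//] bad; case: ltnP => // lt_bn.
have [lt_bk|le_kb] := ltnP b k; first by rewrite bin_small.
by rewrite ['C(n - _, _)]bin_small ?muln0 //; lia.
Qed.

Lemma taily_term_eq0 n s k : (0 < k)%N ->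
  ~~ ((0 <= k%:Z + s) && (3 * k%:Z + s <= n%:Z)) -> taily_term n s k = 0%N.
Proof.
rewrite /taily_term; case: k => // j _.
case E: (_ + s - 1) => [b|//] bad; case: ltnP => // lt_bn.
have [lt_bk|le_kb] := ltnP b j; first by rewrite bin_small.
by rewrite ['C(n - _, _)]bin_small ?muln0 //; lia.
Qed.

Lemma heady_termE n s k : 0 <= k%:Z + s -> 3 * k%:Z + s <= n%:Z - 1 ->
  heady_term n s k =
  ('C(`|(2 * k%:Z + s)%R|, k) * 'C(`|(n%:Z - s - 1 - 2 * k%:Z)%R|, k))%N.
Proof.
move=> ks_ge0 ks_le; rewrite /heady_term.
have -> : `|(n%:Z - s - 1 - 2 * k%:Z)%R|%N = (n - `|(2 * k%:Z + s)%R|.+1)%N by lia.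
have : (`|(2 * k%:Z + s)%R| < n)%N by lia.
have : 0 <= 2 * k%:Z + s by lia.
by case: (2 * _ + s) => // b _ /= ->.
Qed.

Lemma taily_termE n s k :
  (0 < k)%N -> 0 <= k%:Z + s -> 3 * k%:Z + s <= n%:Z ->
  taily_term n s k =
  ('C(`|(2 * k%:Z + s - 1)%R|, k.-1) * 'C(`|(n%:Z - s - 2 * k%:Z)%R|, k))%N.
Proof.
case: k => // j _ ks_ge0 ks_le; rewrite /taily_term.
have -> : `|(n%:Z - s - 2 * j.+1%:Z)%R|%N = (n - `|(2 * j.+1%:Z + s - 1)%R|.+1)%N by lia.
have : (`|(2 * j.+1%:Z + s - 1)%R| < n)%N by lia.
have : 0 <= 2 * j.+1%:Z + s - 1 by lia.
by case: (_ + s - 1) => // b _ /= ->.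
Qed.

(** The bound [K] is left free because the taily recurrence shifts [k]: the step to [K.+1] needs the
    taily sum up to [K.+1] but the heady sum up to [K]. *)
Lemma heady_taily_sum n s K : (n < K)%N ->
  heady s n = (\sum_(0 <= k < K) heady_term n s k)%N /\
  taily s n = (\sum_(0 <= k < K) taily_term n s k)%N.
Proof.
elim: n s K => [|n IHn] s [//|K] lt_nK.
  rewrite heady0 taily0 [X in _ = X /\ _]big1 ?big_nat_recl //=; last first.
    by move=> k _; rewrite /heady_term; case: (_ + s).
  by rewrite big1 ?addn0 // => k _; case: (_ + s - 1).
have lt_nK1 : (n < K.+1)%N by rewrite ltnW.
split.
  rewrite heady_rec (IHn _ _ lt_nK1).1 (IHn _ _ lt_nK1).2 -big_split.
  by apply: eq_bigr => k _; rewrite heady_term_rec.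
rewrite taily_rec (IHn _ _ lt_nK1).2 (IHn _ _ lt_nK).1 !big_nat_recl //.
rewrite -addnA -big_split; congr (_ + _)%N.
by apply: eq_bigr => k _; rewrite /= -taily_term_recS.
Qed.

Lemma sum_nat_support (F G : nat -> nat) (m M l K : nat) :
  (l <= m)%N -> (M <= K)%N ->
  (forall k, (l <= k)%N -> ~~ (m <= k < M)%N -> F k = 0%N) ->
  (forall k, (m <= k < M)%N -> F k = G k) ->
  (\sum_(l <= k < K) F k = \sum_(m <= k < M) G k)%N.
Proof.
move=> le_lm le_MK F0 FG.
rewrite -(eq_big_nat _ _ FG) (big_nat_widen _ _ _ _ _ le_MK) [RHS](big_nat_widenl _ l) //.
rewrite [LHS](bigID (fun k => (m <= k < M)%N)) /= [X in (_ + X)%N]big_nat_cond.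
rewrite [X in (_ + X)%N]big1 ?addn0.
  by apply: eq_bigl => k; rewrite andbC.
by move=> k /andP[/andP[le_lk _] /(F0 _ le_lk)].
Qed.

(* On the stated ranges of s, every integer under an absolute value that      *)
(* reaches a sum is nonnegative (for the binomials: at each k in the range of *)
(* summation), so `|_|%N is only the identification of such integers with     *)
(* natural numbers. The quotient (_ %/ _)%Z by a positive integer is the      *)
(* floor.                                                                     *)
Theorem theorem2 (n : nat) (s : int) (n_gt0 : (1 <= n)%N) :
  ((- ((n%:Z - 1) %/ 2)%Z <= s <= n%:Z - 1 ->
      let ns : int := n%:Z - s - 1 in
      heady s n =
        (\sum_(`|(Num.max 0 (- s))%R| <= k < `|(ns %/ 3)%Z|.+1)
           'C(`|(2 * k%:Z + s)%R|, k) * 'C(`|(ns - 2 * k%:Z)%R|, k))%N)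
   /\
   (~~ (- ((n%:Z - 1) %/ 2)%Z <= s <= n%:Z - 1) -> heady s n = 0%N))
  /\
  ((- (n%:Z %/ 2)%Z <= s <= Num.max 0 (n%:Z - 3) ->
      let ns' : int := n%:Z - s in
      taily s n =
        ((s == 0%R) +
         \sum_(`|(Num.max 1 (- s))%R| <= k < `|(ns' %/ 3)%Z|.+1)
           'C(`|(2 * k%:Z + s - 1)%R|, k.-1) * 'C(`|(ns' - 2 * k%:Z)%R|, k))%N)
   /\
   (~~ (- (n%:Z %/ 2)%Z <= s <= Num.max 0 (n%:Z - 3)) -> taily s n = 0%N)).
Proof.
have [headyE tailyE] := heady_taily_sum s (leqnSn n.+1).
split; split => s_range.
- move=> ns; rewrite headyE; apply: sum_nat_support => //; first by lia.
    by move=> k _ k_out; apply: heady_term_eq0; lia.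
  by move=> k k_in; apply: heady_termE; lia.
(* A nonzero term would give [s <= n - 1] from [k >= 0], and [-2s <= n - 1] from [k >= -s]. *)
- by rewrite headyE big1 // => k _; apply: heady_term_eq0; lia.
- move=> ns'; rewrite tailyE big_ltn //; congr (_ + _)%N.
  apply: sum_nat_support; try lia.
    by move=> k k_gt0 k_out; apply: taily_term_eq0; lia.
  by move=> k k_in; apply: taily_termE; lia.
(* The range always contains [s = 0], so the indicator is 0 outside it; a nonzero term with [k >= 1]
   would force [s <= n - 3] and [-2s <= n]. *)
rewrite tailyE big_ltn //= [X in (X + _)%N](_ : _ = 0%N); last by lia.
rewrite big_nat_cond big1 // => k /andP[/andP[k_gt0 _] _].
by apply: taily_term_eq0 => //; lia.
Qed.
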